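(* In any almost $3$-contact metric manifold $(M^{4n+3},\phi_\alpha,\xi_\alpha,\eta_\alpha,g)$ the following formula holds in the horizontal subbundle $\mathcal H$: $$g^\flat_{\mathcal H}=-\Phi_1^\flat\circ\Phi_2^\sharp\circ\Phi_3^\flat.$$
   Context: An almost contact structure on an odd-dimensional manifold $M$ is a triple $(\phi,\xi,\eta)$ with $\phi$ a $(1,1)$-tensor field, $\xi$ a vector field, $\eta$ a $1$-form, such that $\phi^2=-I+\eta\otimes\xi$, $\eta(\xi)=1$. A Riemannian metric $g$ is compatible if $g(\phi E,\phi F)=g(E,F)-\eta(E)\eta(F)$; then the fundamental $2$-form is $\Phi(E,F)=g(E,\phi F)$. An almost $3$-contact metric manifold is a $(4n+3)$-dimensional smooth manifold with three almost contact structures $(\phi_\alpha,\xi_\alpha,\eta_\alpha)$, $\alpha\in\{1,2,3\}$, and a Riemannian metric $g$ compatible with each of them, such that for all $\alpha,\beta$: $\phi_\alpha\phi_\beta-\eta_\beta\otimes\xi_\alpha=\sum_\gamma\epsilon_{\alpha\beta\gamma}\phi_\gamma-\delta_{\alpha\beta}I$, $\phi_\alpha\xi_\beta=\sum_\gamma\epsilon_{\alpha\beta\gamma}\xi_\gamma$, $\eta_\alpha\circ\phi_\beta=\sum_\gamma\epsilon_{\alpha\beta\gamma}\eta_\gamma$, where $\epsilon_{\alpha\beta\gamma}$ is the totally antisymmetric symbol. The horizontal distribution is $\mathcal H=\bigcap_{\alpha=1}^3\ker\eta_\alpha$, and the vertical one is $\langle\xi_1,\xi_2,\xi_3\rangle$.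 $\Phi_\alpha^\flat: X\mapsto\Phi_\alpha(X,\cdot)$ denotes the isomorphism induced by the fundamental $2$-form $\Phi_\alpha$ from horizontal vector fields to $1$-forms that vanish on vertical vector fields (equivalently, sections of $\mathcal H^*$); $\Phi_\alpha^\sharp$ is its inverse. $g^\flat_{\mathcal H}:X\mapsto g(X,\cdot)$ is the isomorphism induced by the metric between the same spaces. *)

(* Defs.v *)
From HB Require Import structures.
From mathcomp Require Import all_boot all_order all_algebra ring.
From mathcomp Require Import all_classical all_reals all_analysis.

Set Implicit Arguments.
Unset Strict Implicit.
Unset Printing Implicit Defensive.

Import Order.TTheory GRing.Theory Num.Theory.
Import numFieldNormedType.Exports.

Local Open Scope classical_set_scope.
Local Open Scope ring_scope.

(* [Ck k U f]: on the open set [U] all partial derivatives of [f] of order at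
   most [k] exist and are continuous. *)
Fixpoint Ck (R : realType) (m k : nat) (U : set 'rV[R]_m) (f : 'rV[R]_m -> R)
    : Prop :=
  {in U, continuous f} /\
  if k is k'.+1 then
    forall i : 'I_m, {in U, forall x, derivable f x (delta_mx 0 i)} /\
                     Ck k' U ('D_(delta_mx 0 i) f)
  else True.

Definition smooth_on (R : realType) (m : nat) (U : set 'rV[R]_m)
    (f : 'rV[R]_m -> R) : Prop := forall k, Ck k U f.

Section SmoothOnTheory.
Context {R : realType} {m : nat}.
Variable U : set 'rV[R]_m.
Hypothesis openU : open U.
Implicit Types (f g : 'rV[R]_m -> R) (k : nat).

Lemma CkW k f : Ck k.+1 U f -> Ck k U f.
Proof.
elim: k f => [|k IH] f [fc fd]; first by split.
by split=> // i; have [dfi Cfi] := fd i; split=> //; exact: IH.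
Qed.

Lemma near_inU x (P : 'rV[R]_m -> Prop) :
  x \in U -> (forall y, y \in U -> P y) -> \forall y \near x, P y.
Proof.
rewrite inE => Ux PU; have := open_nbhs_nbhs (conj openU Ux).
by apply: filterS => y Uy; apply: PU; rewrite inE.
Qed.

Lemma eq_in_continuous f g :
  {in U, f =1 g} -> {in U, continuous f} -> {in U, continuous g}.
Proof.
move=> fg fc x xU; rewrite /continuous_at -(fg x xU).
have nfg : \forall y \near x, f y = g y by exact: near_inU xU fg.
by apply: cvg_trans (fc x xU); exact: (near_eq_cvg nfg).
Qed.

Lemma eq_Ck k f g : {in U, f =1 g} -> Ck k U f -> Ck k U g.
Proof.
elim: k f g => [|k IH] f g fg [fc fd].
  by split=> //; exact: eq_in_continuous fg fc.
split; first exact: eq_in_continuous fg fc.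
move=> i; have [dfi Cfi] := fd i; split.
  by move=> x xU; apply: near_eq_derivable (dfi x xU); exact: near_inU xU fg.
by apply: IH _ Cfi => x xU; apply: near_eq_derive; exact: near_inU xU fg.
Qed.

Lemma Ck_cst k c : Ck k U (cst c).
Proof.
elim: k c => [|k IH] c; split=> //; try by move=> x xU; exact: cst_continuous.
move=> i; split; first by move=> x _; exact: derivable_cst.
have := IH 0; apply: eq_Ck => x _; by rewrite derive_cst.
Qed.

Lemma CkD k f g : Ck k U f -> Ck k U g -> Ck k U (f + g).
Proof.
elim: k f g => [|k IH] f g [fc fd] [gc gd]; split=> //.
- by move=> x xU; exact: (cvgD (fc x xU) (gc x xU)).
- by move=> x xU; exact: (cvgD (fc x xU) (gc x xU)).
move=> i; have [dfi Cfi] := fd i; have [dgi Cgi] := gd i; split.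
  by move=> x xU; exact: (derivableD (dfi x xU) (dgi x xU)).
apply: eq_Ck _ (IH _ _ Cfi Cgi) => x xU.
by rewrite (deriveD (dfi x xU) (dgi x xU)).
Qed.

Lemma CkM k f g : Ck k U f -> Ck k U g -> Ck k U (f * g).
Proof.
elim: k f g => [|k IH] f g Cf Cg; have [fc fd] := Cf; have [gc gd] := Cg;
  split=> //.
- by move=> x xU; exact: (cvgM (fc x xU) (gc x xU)).
- by move=> x xU; exact: (cvgM (fc x xU) (gc x xU)).
move=> i; have [dfi Cfi] := fd i; have [dgi Cgi] := gd i; split.
  by move=> x xU; exact: (derivableM (dfi x xU) (dgi x xU)).
apply: eq_Ck _ (CkD (IH _ _ (CkW Cf) Cgi) (IH _ _ (CkW Cg) Cfi)) => x xU.
by rewrite (deriveM (dfi x xU) (dgi x xU)).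
Qed.

End SmoothOnTheory.

Record chart (R : realType) (m : nat) (T : topologicalType) := Chart {
  chart_dom : set T;
  chart_cod : set 'rV[R]_m;
  chart_map :> T -> 'rV[R]_m;
  chart_inv : 'rV[R]_m -> T;
  open_chart_dom : open chart_dom;
  open_chart_cod : open chart_cod;
  chart_map_cod : {homo chart_map : p / chart_dom p >-> chart_cod p};
  chart_inv_dom : {homo chart_inv : x / chart_cod x >-> chart_dom x};
  chart_mapK : {in chart_dom, cancel chart_map chart_inv};
  chart_invK : {in chart_cod, cancel chart_inv chart_map};
  chart_map_continuous : {in chart_dom, continuous chart_map};
  chart_inv_continuous : {in chart_cod, continuous chart_inv}
}.

Arguments open_chart_dom {R m T} c : rename.
Arguments open_chart_cod {R m T} c : rename.

Definition smooth_transition (R : realType) (m : nat) (T : topologicalType)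
    (c d : chart R m T) : Prop :=
  forall j : 'I_m,
    smooth_on (chart_cod c `&` chart_inv c @^-1` chart_dom d)
              (fun x => d (chart_inv c x) 0 j).

(* The atlas need not be maximal; it determines a unique maximal one, with the
   same smooth functions. *)
Record manifold (R : realType) (m : nat) := Manifold {
  manifold_space :> topologicalType;
  atlas : set (chart R m manifold_space);
  manifold_hausdorff : hausdorff_space manifold_space;
  manifold_second_countable : @second_countable manifold_space;
  atlas_cover : forall p, exists2 c, atlas c & chart_dom c p;
  atlas_smooth : forall c d, atlas c -> atlas d -> smooth_transition c d
}.

Section Tensors.
Context {R : realType} {m : nat}.
Variable M : manifold R m.

Definition smooth (f : M -> R) : Prop :=
  forall c, atlas c -> smooth_on (chart_cod c) (f \o chart_inv c).

Lemma smooth_cst (a : R) : smooth (cst a).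
Proof. by move=> c _ k; exact: (Ck_cst (open_chart_cod c) k a). Qed.

Lemma smoothD f g : smooth f -> smooth g -> smooth (f + g).
Proof.
move=> sf sg c Ac k.
exact: (CkD (open_chart_cod c) (sf c Ac k) (sg c Ac k)).
Qed.

Lemma smoothM f g : smooth f -> smooth g -> smooth (f * g).
Proof.
move=> sf sg c Ac k.
exact: (CkM (open_chart_cod c) (sf c Ac k) (sg c Ac k)).
Qed.

Lemma smoothZ (a : R) f : smooth f -> smooth (a *: f).
Proof. by move=> sf; exact: (smoothM (smooth_cst a) sf). Qed.

Lemma smoothN f : smooth f -> smooth (- f).
Proof. by move=> sf; rewrite -scaleN1r; exact: smoothZ. Qed.

Definition smooth_pred : {pred (M -> R)} := fun f => `[< smooth f >].

Lemma smooth_subring : subring_closed smooth_pred.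
Proof.
split=> [|f g|f g]; first exact/asboolP/smooth_cst.
  by move=> /asboolP sf /asboolP sg; apply/asboolP/smoothD => //; exact: smoothN.
by move=> /asboolP sf /asboolP sg; apply/asboolP/smoothM.
Qed.

Lemma smooth_submod : submod_closed smooth_pred.
Proof.
split=> [|a f g]; first exact/asboolP/smooth_cst.
by move=> /asboolP sf /asboolP sg; apply/asboolP/smoothD => //; exact: smoothZ.
Qed.

HB.instance Definition _ :=
  GRing.isSubringClosed.Build (M -> R) smooth_pred smooth_subring.
HB.instance Definition _ :=
  GRing.isSubSemiModClosed.Build R (M -> R) smooth_pred smooth_submod.

Record Cinf := CinfMk {
  Cinf_val :> M -> R;
  Cinf_smooth : Cinf_val \in smooth_pred
}.

HB.instance Definition _ := [isSub for Cinf_val].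
HB.instance Definition _ := [Choice of Cinf by <:].
HB.instance Definition _ := 
  GRing.SubChoice_isSubComPzRing.Build (M -> R) smooth_pred Cinf
    (subringClosedP smooth_pred).
HB.instance Definition _ := [SubZmodule_isSubLmodule of Cinf by <:].

(* Tangent vectors at [p] are the derivations at [p]. *)
Definition derivation_at (p : M) (v : Cinf -> R) : Prop :=
  (forall (a : R) (f g : Cinf), v (a *: f + g) = a * v f + v g) /\
  (forall f g : Cinf, v (f * g) = f p * v g + g p * v f).

Definition tangent_pred (p : M) : {pred (Cinf -> R)} :=
  fun v => `[< derivation_at p v >].

Lemma tangent_submod p : submod_closed (tangent_pred p).
Proof.
split=> [|a v w].
  by apply/asboolP; split=> [a f g|f g]; rewrite /= !mulr0 addr0.
move=> /asboolP[vl vM] /asboolP[wl wM]; apply/asboolP.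
have E h : (a *: v + w) h = a * v h + w h by [].
by split=> [b f g|f g]; rewrite !E ?vl ?wl ?vM ?wM; ring.
Qed.

HB.instance Definition _ p :=
  GRing.isSubmodClosed.Build R (Cinf -> R) (tangent_pred p) (tangent_submod p).

Section TangentSpace.
Variable p : M.

Record tangent := TangentMk {
  tangent_val :> Cinf -> R;
  tangent_derivation : tangent_val \in tangent_pred p
}.

HB.instance Definition _ := [isSub for tangent_val].
HB.instance Definition _ := [Choice of tangent by <:].
HB.instance Definition _ := [SubChoice_isSubZmodule of tangent by <:].
HB.instance Definition _ := [SubZmodule_isSubLmodule of tangent by <:].

End TangentSpace.

(* A field of vectors, covectors, endomorphisms or bilinear forms is smooth when
   it produces smooth functions from smooth functions and smooth vector
   fields. *)
Record vfield := VField {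
  vfield_val :> forall p, tangent p;
  vfield_smooth : forall f : Cinf, smooth (fun p => vfield_val p f)
}.

Record form1 := Form1 {
  form1_val :> forall p, tangent p -> R;
  form1_linear : forall p (a : R) (v w : tangent p),
    form1_val (a *: v + w) = a * form1_val v + form1_val w;
  form1_smooth : forall X : vfield, smooth (fun p => form1_val (X p))
}.

Record tensor11 := Tensor11 {
  tensor11_val :> forall p, tangent p -> tangent p;
  tensor11_linear : forall p (a : R) (v w : tangent p),
    tensor11_val (a *: v + w) = a *: tensor11_val v + tensor11_val w;
  tensor11_smooth : forall (X : vfield) (f : Cinf),
    smooth (fun p => tensor11_val (X p) f)
}.

Record riemannian := Riemannian {
  riemannian_val :> forall p, tangent p -> tangent p -> R;
  riemannian_linear : forall p (a : R) (u v w : tangent p),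
    riemannian_val (a *: u + v) w = a * riemannian_val u w + riemannian_val v w;
  riemannian_sym : forall p (v w : tangent p),
    riemannian_val v w = riemannian_val w v;
  riemannian_pos : forall p (v : tangent p), v != 0 -> 0 < riemannian_val v v;
  riemannian_smooth : forall X Y : vfield,
    smooth (fun p => riemannian_val (X p) (Y p))
}.

End Tensors.

Arguments vfield_val {R m M} _ p.
Arguments form1_val {R m M} _ p _.
Arguments tensor11_val {R m M} _ p _.
Arguments riemannian_val {R m M} _ p _ _.

Definition almost_contact (R : realType) (m : nat) (M : manifold R m)
    (phi : tensor11 M) (xi : vfield M) (eta : form1 M) : Prop :=
  (forall p v, phi p (phi p v) = - v + eta p v *: xi p) /\
  (forall p, eta p (xi p) = 1).

Definition compatible (R : realType) (m : nat) (M : manifold R m)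
    (g : riemannian M) (phi : tensor11 M) (eta : form1 M) : Prop :=
  forall p v w, g p (phi p v) (phi p w) = g p v w - eta p v * eta p w.

(* The indices 1, 2, 3 of the structures. *)
Definition i1 : 'I_3 := 0.
Definition i2 : 'I_3 := 1.
Definition i3 : 'I_3 := 1 + 1.

(* The totally antisymmetric symbol with [eps i1 i2 i3 = 1]; [+] is addition
   modulo 3, so the first case lists the cyclic permutations. *)
Definition eps (R : realType) (a b c : 'I_3) : R :=
  if (b == a + 1) && (c == a + 1 + 1) then 1
  else if (c == a + 1) && (b == a + 1 + 1) then -1
  else 0.

Fact eps_id (R : realType) (a c : 'I_3) : eps R a a c = 0.
Proof.
rewrite /eps; have /negbTE -> : a != a + 1 by case: a => -[|[|[|]]].
have /negbTE -> : a != a + 1 + 1 by case: a => -[|[|[|]]].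
by rewrite andbF.
Qed.

Record almost_3contact_metric (R : realType) (n : nat)
    (M : manifold R (4 * n + 3)%N) := Almost3ContactMetric {
  phi : 'I_3 -> tensor11 M;
  xi : 'I_3 -> vfield M;
  eta : 'I_3 -> form1 M;
  met : riemannian M;
  phi_xi_eta_contact : forall a, almost_contact (phi a) (xi a) (eta a);
  met_compatible : forall a, compatible met (phi a) (eta a);
  phi_phi : forall a b p v,
    phi a p (phi b p v) - eta b p v *: xi a p =
    \sum_c eps R a b c *: phi c p v - (a == b)%:R *: v;
  phi_xi : forall a b p, phi a p (xi b p) = \sum_c eps R a b c *: xi c p;
  eta_phi : forall a b p v, eta a p (phi b p v) = \sum_c eps R a b c * eta c p v
}.

Section Horizontal.
Context {R : realType} {n : nat} {M : manifold R (4 * n + 3)%N}.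
Variable S : almost_3contact_metric M.

Definition fundamental (a : 'I_3) (p : M) (v w : tangent p) : R :=
  met S p v (phi S a p w).

Definition horizontal (X : vfield M) : Prop := forall a p, eta S a p (X p) = 0.

Definition vertical (X : vfield M) : Prop :=
  forall p, exists k : 'I_3 -> R, X p = \sum_a k a *: xi S a p.

Definition hfield : Type := {X : vfield M | horizontal X}.

(* Sections of the dual of the horizontal bundle, seen as the 1-forms that
   vanish on vertical vector fields. *)
Record hform := HForm {
  hform_val :> form1 M;
  hform_vertical : forall V, vertical V -> forall p, hform_val p (V p) = 0
}.

Fact hform_opp_linear (w : hform) p (a : R) (u v : tangent p) :
  - w p (a *: u + v) = a * - w p u + - w p v.
Proof. by rewrite form1_linear opprD mulrN. Qed.

Fact hform_opp_smooth (w : hform) (X : vfield M) :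
  smooth (fun p => - w p (X p)).
Proof. exact: smoothN (form1_smooth w X). Qed.

Fact hform_opp_vertical (w : hform) V :
  vertical V -> forall p, - w p (V p) = 0.
Proof. by move=> vV p; rewrite hform_vertical// oppr0. Qed.

Definition hform_opp (w : hform) : hform :=
  @HForm (Form1 (hform_opp_linear w) (hform_opp_smooth w))
    (@hform_opp_vertical w).

Fact tensor11_linear0 (t : tensor11 M) p : t p 0 = 0.
Proof. by have := tensor11_linear t (-1) 0 (0 : tangent p);
  rewrite !scaler0 addr0 scaleN1r addNr. Qed.

Fact met0l p (v : tangent p) : met S p 0 v = 0.
Proof.
by have := riemannian_linear (met S) (-1) 0 0 v; rewrite scaler0 addr0 mulN1r addNr.
Qed.

Fact met_linearr p (v : tangent p) (a : R) (u w : tangent p) :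
  met S p v (a *: u + w) = a * met S p v u + met S p v w.
Proof. by rewrite riemannian_sym riemannian_linear !(riemannian_sym _ v). Qed.

Fact met_sumr p (v : tangent p) (k : 'I_3 -> R) (u : 'I_3 -> tangent p) :
  met S p v (\sum_a k a *: u a) = \sum_a k a * met S p v (u a).
Proof.
elim/big_rec2: _ => [|a y z _ <-]; last by rewrite met_linearr.
by rewrite riemannian_sym met0l.
Qed.

Fact met_xi (X : hfield) a p : met S p (sval X p) (xi S a p) = 0.
Proof.
have phi0 : phi S a p (xi S a p) = 0.
  by rewrite phi_xi big1// => c _; rewrite eps_id scale0r.
have := met_compatible S a (sval X p) (xi S a p).
by rewrite phi0 [in X in X = _]riemannian_sym met0l (svalP X a p) mul0r subr0 => <-.
Qed.

Fact met_vertical (X : hfield) V :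
  vertical V -> forall p, met S p (sval X p) (V p) = 0.
Proof.
move=> vV p; have [k ->] := vV p.
by rewrite met_sumr big1// => a _; rewrite met_xi mulr0.
Qed.

Fact met_phi_xi (X : hfield) a b p :
  fundamental a (sval X p) (xi S b p) = 0.
Proof.
by rewrite /fundamental phi_xi met_sumr big1// => c _; rewrite met_xi mulr0.
Qed.

Fact fundamental_linear (X : hfield) a p (k : R) (u v : tangent p) :
  fundamental a (sval X p) (k *: u + v) =
  k * fundamental a (sval X p) u + fundamental a (sval X p) v.
Proof. by rewrite /fundamental tensor11_linear met_linearr. Qed.

Fact fundamental_smooth (X : hfield) a (Y : vfield M) :
  smooth (fun p => fundamental a (sval X p) (Y p)).
Proof.
exact: (riemannian_smooth (met S) (sval X) (VField (tensor11_smooth (phi S a) Y))).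
Qed.

Fact fundamental_vertical (X : hfield) a V :
  vertical V -> forall p, fundamental a (sval X p) (V p) = 0.
Proof.
move=> vV p; have [k ->] := vV p.
elim/big_rec: _ => [|c y _ IH].
  by rewrite /fundamental tensor11_linear0 riemannian_sym met0l.
by rewrite fundamental_linear met_phi_xi mulr0 add0r.
Qed.

Definition metric_flat (X : hfield) : hform :=
  @HForm (@Form1 _ _ _ (fun p v => met S p (sval X p) v)
            (fun p => @met_linearr p (sval X p))
            (riemannian_smooth (met S) (sval X)))
    (@met_vertical X).

Definition flat (a : 'I_3) (X : hfield) : hform :=
  @HForm (Form1 (@fundamental_linear X a) (@fundamental_smooth X a))
    (@fundamental_vertical X a).

Fact vfield0_smooth (f : Cinf M) : smooth (fun p : M => (0 : tangent p) f).
Proof. exact: smooth_cst. Qed.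

Fact horizontal0 : horizontal (VField vfield0_smooth).
Proof.
move=> a p /=; have := form1_linear (eta S a) (-1) 0 (0 : tangent p).
by rewrite scaler0 addr0 mulN1r addNr.
Qed.

(* The inverse of the isomorphism [flat a]; ['pinv_] needs a default value,
   which plays no role since [flat a] is bijective. *)
Definition sharp (a : 'I_3) : hform -> hfield :=
  'pinv_(fun=> exist _ _ horizontal0) setT (flat a).

End Horizontal.

Arguments hform_opp {R n M S} w.
Arguments metric_flat {R n M} S X.
Arguments flat {R n M} S a X.
Arguments sharp {R n M} S a w.

(* Main.v *)
Require Import Defs.
From mathcomp Require Import all_boot all_order all_algebra.
From mathcomp Require Import all_classical all_reals all_analysis.

(** For horizontal [X], skew-symmetry of [phi_1] and [phi_1 phi_2 = phi_3] modulo
    the vertical bundle give [Phi_2(- phi_1 X, v) = g(X, phi_1 phi_2 v)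
    = Phi_3(X, v)], so that [- phi_1 X] is the image of [Phi_3(X, .)] under the
    inverse of [Phi_2]. Compatibility gives [Phi_1(- phi_1 X, v) = - g(X, v)]. *)

Set Implicit Arguments.
Unset Strict Implicit.
Unset Printing Implicit Defensive.

Import Order.TTheory GRing.Theory Num.Theory.

Local Open Scope classical_set_scope.
Local Open Scope ring_scope.

Section AlmostThreeContact.
Context {R : realType} {n : nat} {M : manifold R (4 * n + 3)%N}.
Variable S : almost_3contact_metric M.

Lemma vfield_eq (X Y : vfield M) : (forall p, X p = Y p) -> X = Y.
Proof.
case: X Y => [x sx] [y sy] /= xy.
have exy : x = y by apply: functional_extensionality_dep.
by subst y; congr VField; exact: Prop_irrelevance.
Qed.

Lemma hfield_eq (X Y : hfield S) : (forall p, sval X p = sval Y p) -> X = Y.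
Proof.
by move=> XY; apply: eq_sig_hprop (vfield_eq XY) => *; exact: Prop_irrelevance.
Qed.

Lemma hform_eq (w z : hform S) : (forall p v, w p v = z p v) -> w = z.
Proof.
case: w z => [[w lw sw] vw] [[z lz sz] vz] /= wz.
have ewz : w = z.
  apply: functional_extensionality_dep => p.
  exact: functional_extensionality_dep (wz p).
(* The proof fields have types that depend on the function, so proof irrelevance applies to them
   only once the functions coincide. *)
subst z.
have ? : lw = lz by exact: Prop_irrelevance.
have ? : sw = sz by exact: Prop_irrelevance.
subst lz sz; congr HForm; exact: Prop_irrelevance.
Qed.

Lemma metNl p (u v : tangent p) : met S p (- u) v = - met S p u v.
Proof.
by have := riemannian_linear (met S) (-1) u 0 v;
  rewrite met0l !addr0 scaleN1r mulN1r.
Qed.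

Lemma metNr p (u v : tangent p) : met S p u (- v) = - met S p u v.
Proof. by rewrite riemannian_sym metNl riemannian_sym. Qed.

Lemma metBl p (u v w : tangent p) :
  met S p (u - v) w = met S p u w - met S p v w.
Proof.
by have := riemannian_linear (met S) 1 u (- v) w; rewrite scale1r mul1r metNl.
Qed.

Lemma etaN a p (v : tangent p) : eta S a p (- v) = - eta S a p v.
Proof.
have eta0 : eta S a p 0 = 0.
  have := form1_linear (eta S a) (-1) 0 (0 : tangent p).
  by rewrite scaler0 addr0 mulN1r addNr.
have := form1_linear (eta S a) (-1) v 0.
by rewrite scaleN1r eta0 !addr0 mulN1r.
Qed.

Lemma etaB a p (u v : tangent p) :
  eta S a p (u - v) = eta S a p u - eta S a p v.
Proof.
have := form1_linear (eta S a) 1 u (- v).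
by rewrite scale1r mul1r etaN.
Qed.

Lemma opp_phi_smooth a (X : vfield M) (f : Cinf M) :
  smooth (fun p => (- phi S a p (X p)) f).
Proof. exact: smoothN (tensor11_smooth (phi S a) X f). Qed.

(** Each [eta_b] composed with [phi_a] is a combination of the [eta_c], all of which vanish on
    [X]. *)
Lemma opp_phi_horizontal a (X : hfield S) :
  horizontal S (VField (opp_phi_smooth a (sval X))).
Proof.
move=> b p /=; rewrite etaN eta_phi big1 ?oppr0// => c _.
by rewrite (svalP X) mulr0.
Qed.

Definition opp_phi a (X : hfield S) : hfield S :=
  exist _ _ (opp_phi_horizontal a X).

(** Compatibility applied to [X] and [phi_a w] gives [g(phi_a X, phi_a (phi_a w)) = g(X, phi_a w)],
    since [eta_a X = 0]. Here [phi_a (phi_a w)] is [- w] plus a multiple of [xi_a], and [phi_a X] is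
    orthogonal to [xi_a]. *)
Lemma met_opp_phi a (X : hfield S) p (w : tangent p) :
  met S p (sval (opp_phi a X) p) w = met S p (sval X p) (phi S a p w).
Proof.
have [phi2 _] := phi_xi_eta_contact S a.
have := met_compatible S a (sval X p) (phi S a p w).
rewrite (svalP X a p) mul0r subr0 phi2 => <-.
have := met_xi (opp_phi a X) a p; rewrite /= metNl => /eqP.
rewrite oppr_eq0 => /eqP phiX_xi.
by rewrite addrC met_linearr phiX_xi mulr0 add0r metNr metNl.
Qed.

Lemma phi_phi_horizontal a p (w : tangent p) :
  eta S a p w = 0 -> phi S a p (phi S a p w) = - w.
Proof.
by move=> w0; have [-> _] := phi_xi_eta_contact S a; rewrite w0 scale0r addr0.
Qed.

(** The difference [w = X - Y] at [p] is horizontal, so testing both forms on [phi_a w] amounts to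
    pairing with [- w]. Hence [g(w, w) = 0], against positivity if [w] is nonzero. *)
Lemma flat_inj a : injective (flat S a).
Proof.
move=> X Y XY; apply: hfield_eq => p; apply/eqP; rewrite -subr_eq0.
apply/negPn/negP => /(riemannian_pos (met S)); set w := _ - _.
have w0 : eta S a p w = 0 by rewrite etaB (svalP X) (svalP Y) subrr.
have : fundamental S a (sval X p) (phi S a p w) =
       fundamental S a (sval Y p) (phi S a p w).
  by have := congr1 (fun z : hform S => z p (phi S a p w)) XY.
rewrite /fundamental phi_phi_horizontal// !metNr => /oppr_inj e.
by rewrite {1}/w metBl e subrr ltxx.
Qed.

Lemma flatK a : cancel (flat S a) (sharp S a).
Proof.
(* A value of [flat S a] has a preimage, unique by injectivity, so ['pinv_] returns it rather than
   its default. *)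
move=> X; rewrite /sharp pinvKV ?inE// => u v _ _; exact: flat_inj.
Qed.

Lemma phi1_phi2 p (v : tangent p) :
  phi S i1 p (phi S i2 p v) = eta S i2 p v *: xi S i1 p + phi S i3 p v.
Proof.
have /eqP := phi_phi S i1 i2 v; rewrite subr_eq => /eqP ->.
(* The indices differ, so the Kronecker term vanishes; in the sum only [c = i3] survives, with
   coefficient 1. *)
rewrite addrC; congr (_ + _); rewrite scale0r subr0 (bigD1 i3)//= big1 => [|c].
  by rewrite addr0 scale1r.
by case: c => -[|[|[|//]]] ? //= _; rewrite scale0r.
Qed.

Lemma flat_opp_phi (X : hfield S) : flat S i2 (opp_phi i1 X) = flat S i3 X.
Proof.
apply: hform_eq => p v.
change (met S p (sval (opp_phi i1 X) p) (phi S i2 p v) =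
        met S p (sval X p) (phi S i3 p v)).
by rewrite met_opp_phi phi1_phi2 met_linearr met_xi mulr0 add0r.
Qed.

End AlmostThreeContact.

Theorem corollary4p2 (R : realType) (n : nat) (M : manifold R (4 * n + 3)%N)
    (S : almost_3contact_metric M) :
  metric_flat S =
  hform_opp \o flat S i1 \o sharp S i2 \o flat S i3.
Proof.
(* Writing [flat S i3 X] as a value of [flat S i2] lets [sharp S i2] cancel. *)
apply/funext => X; rewrite /= -flat_opp_phi flatK; apply: hform_eq => p v.
change (met S p (sval X p) v =
        - met S p (sval (opp_phi i1 X) p) (phi S i1 p v)).
by rewrite metNl opprK met_compatible (svalP X) mul0r subr0.
Qed.
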